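(* Let $\mathcal{X}=(X,r,\rho,\mu)\in\mathbb{X}$. Then $\mathcal{X}$ is a compact metric finite measure space (i.e. $\mathcal{X}\in\mathbb{X}_{\mathrm c}$) if and only if it has finite total mass and satisfies the global lower mass-bound property, i.e. $\mathfrak{m}_\delta(\mathcal{X})>0$ for all $\delta>0$.
   Context: A (pointed, complete, separable) metric measure space $(X,r,\rho,\mu)$ consists of a complete separable metric space $(X,r)$, a point $\rho\in X$ (the root) and a Borel measure $\mu$ on $X$; it is boundedly finite if $\mu$ is finite on all bounded sets. Two metric measure spaces are equivalent if there is a (surjective) isometry $\phi\colon\operatorname{supp}(\mu)\cup\{\rho\}\to\operatorname{supp}(\mu')\cup\{\rho'\}$ with $\phi(\rho)=\rho'$ and $\phi_*\mu=\mu'$. $\mathbb{X}$ is the set of equivalence classes of metric boundedly finite measure spaces; $\mathbb{X}_{\mathrm c}\subseteq\mathbb{X}$ is the subset of classes containing a representative with $(X,r)$ compact. Lower mass functions: $\mathfrak{m}_\delta^R((X,r,\rho,\mu)):=\inf\{\mu(\overline{B}_r(x,\delta)):x\in B_r(\rho,R)\cap\operatorname{supp}(\mu)\}$ (with $B_r$, $\overline{B}_r$ open and closed balls, $\inf\emptyset=\infty$) and $\mathfrak{m}_\delta:=\lim_{R\to\infty}\mathfrak{m}_\delta^R=\inf_{R>0}\mathfrak{m}_\delta^R$. *)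

(* Defs.v *)
From HB Require Import structures.
From mathcomp Require Import all_boot all_order all_algebra.
From mathcomp Require Import all_classical all_reals all_analysis.

Set Implicit Arguments.
Unset Strict Implicit.
Unset Printing Implicit Defensive.

Import Order.TTheory GRing.Theory Num.Theory.
Import numFieldNormedType.Exports.

Local Open Scope classical_set_scope.
Local Open Scope ring_scope.

(* The canonical [point] that [completeType] requires carries no meaning here;
   the root of a metric measure space is the separate field [mm_root]. *)
#[short(type="completeMetricType")]
HB.structure Definition CompleteMetric (R : numDomainType) :=
  { T of Complete T & Metric R T }.

Definition separable (T : topologicalType) :=
  exists2 D : set T, countable D & dense D.

Notation borel T := (g_sigma_algebraType (@open T)).

Section metric_notions.
Context {R : realType} {T : completeMetricType R}.

(* Not the library's [closed_ball], which is the closure of the open ball and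
   can be strictly smaller in a general metric space. *)
Definition closed_mball (x : T) (e : R) : set T := [set y | mdist x y <= e].

Definition mbounded (A : set T) := exists (x : T) (e : R), A `<=` ball x e.

Definition msupport (mu : set (borel T) -> \bar R) : set T :=
  [set x | forall U : set T, open_nbhs x U -> (0 < mu U)%E].

End metric_notions.

Record mmspace (R : realType) := MMSpace {
  mm_carrier :> completeMetricType R ;
  mm_separable : separable mm_carrier ;
  mm_root : mm_carrier ;
  mm_measure : {measure set (borel mm_carrier) -> \bar R} ;
  mm_boundedly_finite : forall A : set (borel mm_carrier),
    measurable A -> mbounded A -> (mm_measure A < +oo)%E }.

Definition mm_supp (R : realType) (X : mmspace R) : set X :=
  msupport (mm_measure X).
Arguments mm_supp {R} X _.

Definition mm_rooted_supp (R : realType) (X : mmspace R) : set X :=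
  mm_supp X `|` [set mm_root X].
Arguments mm_rooted_supp {R} X _.

Section mmspace_notions.
Context {R : realType}.
Implicit Types X Y : mmspace R.

(* The isometry is represented by a function on all of [X] whose values outside
   [mm_rooted_supp X] are irrelevant. As [mm_rooted_supp X] has full measure,
   the last clause says that the pushforward of the measure of [X] is that of
   [Y]. *)
Definition mm_equiv X Y := exists phi : X -> Y,
  [/\ {in mm_rooted_supp X &, forall x y, mdist (phi x) (phi y) = mdist x y},
      phi @` mm_rooted_supp X = mm_rooted_supp Y,
      phi (mm_root X) = mm_root Y &
      forall B : set (borel Y), measurable B ->
        mm_measure Y B = mm_measure X (mm_rooted_supp X `&` phi @^-1` B)].

Definition mm_class X : set (mmspace R) := [set Y | mm_equiv X Y].

(* Membership of an equivalence class in X_c; the total mass of a compact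
   representative is finite by [mm_boundedly_finite]. *)
Definition compact_class (C : set (mmspace R)) :=
  exists2 Y : mmspace R, C Y & compact [set: Y].

Definition lower_mass_within X (delta r : R) : \bar R :=
  ereal_inf [set mm_measure X (closed_mball x delta) |
             x in ball (mm_root X) r `&` mm_supp X].

Definition lower_mass X (delta : R) : \bar R :=
  lim (lower_mass_within X delta r @[r --> +oo]).

Lemma lower_massE X (delta : R) : lower_mass X delta =
  ereal_inf [set lower_mass_within X delta r | r in [set r | 0 < r]].
Proof.
have noninc : {homo lower_mass_within X delta : r s / r <= s >-> (s <= r)%E}.
  move=> r s rs; apply: ereal_inf_le_tmp => _ [x [xr xS] <-].
  by exists x => //; split=> //; exact: le_ball xr.
rewrite /lower_mass; have /cvg_lim -> // := nonincreasing_cvge noninc.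
apply/eqP; rewrite eq_le; apply/andP; split.
  by apply: ereal_inf_le_tmp => _ [r _ <-]; exists r.
apply: le_ereal_inf_tmp => _ [r _ <-].
apply: (@le_trans _ _ (lower_mass_within X delta (Num.max r 1))).
  apply: ereal_inf_lbound; exists (Num.max r 1) => //=.
  by rewrite lt_max ltr01 orbT.
by apply: noninc; rewrite le_max lexx.
Qed.

End mmspace_notions.

(* Main.v *)
From mathcomp Require Import lra.
Require Import Defs.
From HB Require Import structures.
From mathcomp Require Import all_boot all_order all_algebra.
From mathcomp Require Import all_classical all_reals all_analysis.

(**
  Suppose that the class of X has a compact representative Y, and let phi be
  the isometry from the rooted support of X onto that of Y. Near each y in Y
  the masses of the delta-balls of X centred at support points that phi sends
  close to y are bounded below: either there are no such points, or one of
  them, x0, is chosen, and the ball around x0 of radius delta/2, which has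
  positive mass, lies in all those delta-balls. Compactness of Y turns these
  local bounds into a global one ([mm_equiv_compact_lower_mass]). The total
  mass is finite because Y is bounded and X, Y have the same total mass
  ([compact_finite_mass], [mm_equiv_total_mass]).

  Conversely, suppose that the total mass M is finite and that every closed
  ball of radius e/3 around a support point has mass at least m > 0. Points of
  the support that are pairwise at distance at least e are centres of disjoint
  balls of radius e/3, so there are at most M/m of them, and a maximal such
  family covers the support by balls of radius e. Hence the support is
  totally bounded ([mass_bound_totally_bounded]); being closed in a complete
  space, it is compact ([compact_totally_bounded]).

  What remains is to exhibit a compact representative. It is the rooted
  support S of X with the induced metric ([compact_subspace]). Its measure is
  the pushforward of that of X under the map X -> S that is the identity on S
  and sends the rest of X to the root ([retract]). The rest is a null set since
  X is separable ([measure_setC_msupport]), so this is the restriction of the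
  measure of X to S, and it has full support up to the root
  ([compact_rooted_supp_class]).
*)

Import Order.TTheory GRing.Theory Num.Theory.
Import numFieldNormedType.Exports.

Local Open Scope classical_set_scope.
Local Open Scope ring_scope.

(** * Balls and Borel sets of a metric space *)

Lemma ball_mdist {R : realType} {T : metricType R} (x : T) (e : R) (y : T) :
  ball x e y = (mdist x y < e) :> Prop.
Proof. by rewrite ballEmdist. Qed.

Lemma open_mball {R : realType} {T : metricType R} (x : T) (e : R) :
  open (ball x e).
Proof.
rewrite openE => y; rewrite ball_mdist => xy; apply/nbhs_ballP.
exists (e - mdist x y); rewrite /= ?subr_gt0// => z; rewrite !ball_mdist => yz.
by have := metric_triangle x y z; lra.
Qed.

Lemma closed_closed_mball {R : realType} {T : completeMetricType R} (x : T)
  (e : R) : closed (closed_mball x e).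
Proof.
rewrite -openC openE => y /= /negP; rewrite -ltNge => exy; apply/nbhs_ballP.
exists (mdist x y - e); rewrite /= ?subr_gt0// => z; rewrite ball_mdist => yz.
apply/negP; rewrite -ltNge.
by have := metric_triangle x z y; rewrite (metric_sym z y); lra.
Qed.

Lemma open_borel {T : ptopologicalType} (U : set T) :
  open U -> measurable (U : set (borel T)).
Proof. by move=> oU; exact: sub_sigma_algebra. Qed.

Lemma closed_borel {T : ptopologicalType} (C : set T) :
  closed C -> measurable (C : set (borel T)).
Proof.
move=> cC; rewrite -(setCK C); apply: measurableC; apply: open_borel.
exact: closed_openC.
Qed.

Lemma ball_borel {R : realType} {T : completeMetricType R} (x : T) (e : R) :
  measurable (ball x e : set (borel T)).
Proof. by apply: open_borel; exact: open_mball. Qed.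

Lemma closed_mball_borel {R : realType} {T : completeMetricType R} (x : T)
  (e : R) : measurable (closed_mball x e : set (borel T)).
Proof. by apply: closed_borel; exact: closed_closed_mball. Qed.

(** * Compactness and separability *)

(** An ultrafilter that contains a set covered by finitely many balls contains
    one of these balls; so, if it contains a totally bounded set, it is
    Cauchy. *)
Lemma compact_totally_bounded {R : realType} {T : completeMetricType R}
  (A : set T) : closed A ->
  (forall e : R, 0 < e ->
     exists s : seq T, forall y, A y -> exists2 x, x \in s & ball x e y) ->
  compact A.
Proof.
move=> cA tbA; rewrite compact_ultra => F FU FA.
have PF : ProperFilter F by exact: ultra_proper.
have cF : cvg F.
  apply: cauchy_cvg; apply: cauchy_exP => e e0; apply: contrapT => noball.
  have [s sA] := tbA e e0.
  have : F (~` [set y | exists2 x, x \in s & ball x e y]).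
    elim: s {sA} => [|x s IHs].
      by apply: filterS filterT => y _ [].
    have [Fx|Fx] := in_ultra_setVsetC (ball x e) FU.
      by case: noball; exists x.
    apply: filterS (filterI Fx IHs) => y [xy sy] [z].
    by rewrite inE => /predU1P[->//|zs zy]; apply: sy; exists z.
  by move/(filterI FA)/filter_ex => [y [/sA]].
by exists (lim F); split => //; exact: closed_cvg cF.
Qed.

Lemma initial_topology_compact {S : choiceType} {T : topologicalType}
  (f : S -> T) : compact (range f) -> compact [set: initial_topology f].
Proof.
move=> cf F PF _.
have Ff : F (f @^-1` range f) by apply: filterS filterT => a _; exists a.
have [_ [[x _ <-] Fx]] := cf (f @ F) _ Ff.
exists x; split => // A B FA [_ [[W oW <-] /= Wx WB]].
have FfA : F (f @^-1` (f @` A)) by apply: filterS FA => a Aa; exists a.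
have [_ [[a Aa <-] Wa]] := Fx _ _ FfA (open_nbhs_nbhs (conj oW Wx)).
by exists a; split => //; exact: WB.
Qed.

Lemma second_countable_separable {T : ptopologicalType} :
  @second_countable T -> separable T.
Proof.
case=> B cB [oB bB]; exists (get @` B).
  exact: sub_countable (card_image_le _ _) cB.
move=> O [x Ox] oO; have [V [BV Vx] VO] := bB x O (open_nbhs_nbhs (conj oO Ox)).
exists (get V); split; last by exists V.
by apply: VO; apply: getPex; exists x.
Qed.

Lemma dense_sequence {T : ptopologicalType} : separable T ->
  exists u : nat -> T, dense (range u).
Proof.
case=> D /pfcard_geP[->|[u]] dD.
  by have [] := dD setT (ex_intro _ point I) openT => x [].
exists u => O O0 oO; have [x [Ox Dx]] := dD O O0 oO.
by exists x; split=> //; have [n _ <-] := @surj _ _ _ _ u x Dx; exists n.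
Qed.

(** * The support of a measure *)

Lemma msupportP {R : realType} {T : completeMetricType R}
  (mu : {measure set (borel T) -> \bar R}) (x : T) :
  msupport mu x <-> forall e : R, 0 < e -> (0 < mu (ball x e))%E.
Proof.
split=> [xS e e0|xS U [oU Ux]].
  by apply: xS; split; [exact: open_mball|exact: ballxx].
have /nbhs_ballP[e /= e0 eU] : nbhs x U by exact: open_nbhs_nbhs.
apply: lt_le_trans (xS e e0) _.
by apply: le_measure => //; rewrite inE; [exact: ball_borel|exact: open_borel].
Qed.

Lemma closed_msupport {R : realType} {T : completeMetricType R}
  (mu : set (borel T) -> \bar R) : closed (msupport mu).
Proof.
rewrite -openC openE => x; rewrite /= /msupport /=.
move=> /existsNP[U /not_implyP[xU mU]]; have [oU _] := xU.
apply: filterS (open_nbhs_nbhs _) => [y Uy yS|]; last exact: xU.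
by apply: mU; apply: yS.
Qed.

(** A point outside the support has a null ball around it, hence lies in a null
    ball with centre in a countable dense set and radius the inverse of a
    positive integer; there are countably many of these. *)
Lemma measure_setC_msupport {R : realType} {T : completeMetricType R}
  (mu : {measure set (borel T) -> \bar R}) : separable T ->
  mu (~` msupport mu) = 0%E.
Proof.
move=> /dense_sequence[u du].
pose B k n := ball (u k) (n.+1%:R^-1 : R).
pose N k n := if mu (B k n) == 0%E then B k n else set0.
have mS : measurable (msupport mu : set (borel T)).
  by apply: closed_borel; exact: closed_msupport.
apply/negligibleP; first exact: measurableC.
have : mu.-negligible (\bigcup_k \bigcup_n (N k n : set (borel T))).
  apply: negligible_bigcup => k; apply: negligible_bigcup => n; rewrite /N.
  case: eqP => [B0|_]; last exact: negligible_set0.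
  by apply/negligibleP => //; exact: ball_borel.
apply: negligibleS => x /msupportP/existsNP[e /not_implyP[e0 /negP]].
rewrite lt_neqAle measure_ge0 andbT negbK eq_sym => /eqP xe0.
(* Half the radius: a ball of radius at most e/2 whose centre is within e/2
   of x is contained in the null ball of radius e around x. *)
have [n ne] : exists n, n.+1%:R^-1 < e / 2.
  by have [//|n] := @ltr_add_invr R 0 (e / 2) _;
    rewrite ?divr_gt0// add0r => ?; exists n.
have [y [xy [k _ uky]]] : ball x (n.+1%:R^-1 : R) `&` range u !=set0.
  apply: du; last exact: open_mball.
  by exists x; apply: ballxx; rewrite invr_gt0.
rewrite -uky in xy; exists k => //; exists n => //.
rewrite /N ifT; first exact: ball_sym.
apply/eqP; apply: (@subset_measure0 _ _ _ mu _ (ball x e)) => //.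
- exact: ball_borel.
- exact: ball_borel.
- move: xy => + z; rewrite /B !ball_mdist => xk kz.
  have := metric_triangle x (u k) z; set a := _^-1 in ne xk kz *.
  by lra.
Qed.

(** * Uniform lower mass bounds *)

Lemma ereal_gt0_real {R : realType} (c : \bar R) :
  (0 < c)%E -> exists2 m : R, 0 < m & (m%:E <= c)%E.
Proof.
case: c => [l|_|//]; last by exists 1 => //; rewrite leey.
by rewrite lte_fin => l0; exists l.
Qed.

(** The bound is asked to be a real number, although the lower mass may be
    infinite: this happens when the support is empty. *)
Lemma lower_mass_gt0P {R : realType} (X : mmspace R) (delta : R) :
  (0 < lower_mass X delta)%E <->
  exists2 m : R, 0 < m &
    forall x, mm_supp X x -> (m%:E <= mm_measure X (closed_mball x delta))%E.
Proof.
rewrite lower_massE; split=> [L0|[m m0 mX]]; last first.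
  apply: (@lt_le_trans _ _ m%:E); first by rewrite lte_fin.
  apply: le_ereal_inf_tmp => _ [r _ <-].
  by apply: le_ereal_inf_tmp => _ [x [_ xS] <-]; exact: mX.
set L := ereal_inf _ in L0.
have [m m0 mL] := ereal_gt0_real L L0.
exists m => // x xS; apply: (le_trans mL).
apply: (@le_trans _ _ (lower_mass_within X delta (mdist (mm_root X) x + 1))).
  apply: ereal_inf_lbound; exists (mdist (mm_root X) x + 1) => //=.
  by rewrite ltr_wpDl// mdist_ge0.
apply: ereal_inf_lbound; exists x => //; split => //.
by rewrite ball_mdist ltrDl.
Qed.

(** If no finite family of e-balls covers A, points of A can be chosen one after
    the other at distance at least e from each other. Their closed balls of
    radius e/3 are disjoint and each adds at least m to the mass of the union,
    which exceeds the total mass after finitely many steps. *)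
Lemma mass_bound_totally_bounded {R : realType} {T : completeMetricType R}
  (mu : {measure set (borel T) -> \bar R}) (A : set T) (e m : R) :
  (mu setT < +oo)%E -> 0 < e -> 0 < m ->
  (forall x, A x -> (m%:E <= mu (closed_mball x (e / 3)))%E) ->
  exists s : seq T, forall y, A y -> exists2 x, x \in s & ball x e y.
Proof.
move=> finmu e0 m0 mA; apply: contrapT => nocover.
(* The centres s are kept along with the union U of the balls, to choose the
   next point away from them. *)
have packing n : exists s : seq T, exists U : set (borel T),
  [/\ measurable U, ((m *+ n)%:E <= mu U)%E &
      U `<=` [set y | exists2 x, x \in s & closed_mball x (e / 3) y]].
  elim: n => [|n [s [U [mU nU Us]]]].
    by exists [::], set0; rewrite measure0; split.
  have [x [Ax xs]] : exists x, A x /\ ~ exists2 z, z \in s & ball z e x.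
    apply: contrapT => ncover; apply: nocover; exists s => y Ay.
    by apply: contrapT => ys; apply: ncover; exists y.
  exists (x :: s), (U `|` closed_mball x (e / 3)).
  have disj : U `&` closed_mball x (e / 3) = set0.
    rewrite -subset0 => y [/Us[z zs /=]]; rewrite /closed_mball /= => zy xy.
    apply: xs; exists z => //; rewrite ball_mdist.
    by have := metric_triangle z y x; rewrite (metric_sym y x); lra.
  have mB := closed_mball_borel x (e / 3).
  split; first exact: measurableU.
  - by rewrite measureU// mulrS addrC EFinD leeD//; exact: mA.
  - move=> y [/Us[z zs zy]|xy].
      by exists z => //; rewrite inE zs orbT.
    by exists x => //; rewrite inE eqxx.
have Mfin : (mu setT \is a fin_num) by rewrite ge0_fin_numE.
pose M := fine (mu setT).
have [n Mn] : exists n, M < m *+ n.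
  exists (Num.bound (M / m)).
  rewrite -mulr_natr mulrC -ltr_pdivrMr//; apply: archi_boundP.
  by rewrite divr_ge0 ?fine_ge0 ?(ltW m0).
have [s [U [mU nU _]]] := packing n.
have : (mu U <= mu setT)%E by apply: le_measure => //; rewrite inE.
by move/(le_trans nU); rewrite -(fineK Mfin) lee_fin leNgt Mn.
Qed.

(** * Rooted supports and spaces equivalent to a compact one *)

Lemma mm_rooted_supp_borel {R : realType} (X : mmspace R) :
  measurable (mm_rooted_supp X : set (borel X)).
Proof.
apply: measurableU; apply: closed_borel; first exact: closed_msupport.
apply: accessible_closed_set1; apply: hausdorff_accessible.
exact: metric_hausdorff.
Qed.

Lemma measure_mm_rooted_suppI {R : realType} (X : mmspace R)
  (A : set (borel X)) :
  measurable A -> mm_measure X (mm_rooted_supp X `&` A) = mm_measure X A.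
Proof.
move=> mA; have mS := mm_rooted_supp_borel X.
rewrite [RHS](measureDI (mm_measure X) mA mS) setIC.
rewrite -[LHS]add0e; congr (_ + _)%E; apply/esym.
apply: (@subset_measure0 _ _ _ (mm_measure X) _ (~` mm_supp X)).
- exact: measurableD.
- by apply: measurableC; apply: closed_borel; exact: closed_msupport.
- by move=> x [_ xS] xX; apply: xS; left.
- by apply: measure_setC_msupport; exact: mm_separable.
Qed.

Lemma compact_finite_mass {R : realType} (Y : mmspace R) :
  compact [set: Y] -> (mm_measure Y [set: Y] < +oo)%E.
Proof.
move=> /compact_near_coveringP cY; apply: mm_boundedly_finite => //.
have : \forall r \near (+oo : set_system R),
    [set: Y] `<=` (ball (mm_root Y) r : set Y).
  apply: (cY R _ (fun r => ball (mm_root Y) r : set Y)) => y _.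
  have y1 : \forall z \near y, ball y 1 z by exact: nbhsx_ballx.
  near=> z r; rewrite /= ball_mdist.
  apply: (@lt_trans _ _ (mdist (mm_root Y) y + 1)); last first.
    by near: r; apply: nbhs_pinfty_gt; rewrite num_real.
  have : ball y 1 z by near: z.
  by rewrite ball_mdist; have := metric_triangle (mm_root Y) y z; lra.
by move/filter_ex => [r rY]; exists (mm_root Y), r.
Unshelve. all: by end_near. Qed.

(** The lower bound is first found locally on Y, for the support points of X
    that phi sends near a given point of Y, where it may depend on that point;
    compactness of Y then gives one bound for all points. *)
Lemma mm_equiv_compact_lower_mass {R : realType} (X Y : mmspace R) :
  mm_equiv X Y -> compact [set: Y] ->
  forall delta : R, 0 < delta -> (0 < lower_mass X delta)%E.
Proof.
move=> [phi [iso _ _ _]] /compact_near_coveringP cY delta delta0.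
apply/lower_mass_gt0P.
pose P (m : R) (y : Y) := forall x, mm_supp X x -> phi x = y ->
  (m%:E <= mm_measure X (closed_mball x delta))%E.
have : \forall m \near (0 : R)^'+, [set: Y] `<=` P m.
  apply: cY => y _.
  (* Two support points of X that phi sends into the ball of radius delta/4
     around y are less than delta/2 apart, so the ball of radius delta/2 around
     one of them lies in the delta-ball around the other. *)
  have [[x0 [x0S yx0]]|nox0] := pselect (exists x0, mm_supp X x0 /\
      ball y (delta / 4) (phi x0)); last first.
    have yd : \forall z \near y, ball y (delta / 4) z.
      by apply: nbhsx_ballx; rewrite divr_gt0.
    near=> z m => /= x xS xz; exfalso; apply: nox0; exists x; split => //.
    by rewrite xz; near: z.
  have [c c0 cx0] : exists2 c : R, 0 < c &
      (c%:E <= mm_measure X (ball x0 (delta / 2)))%E.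
    apply: ereal_gt0_real; apply: (msupportP (mm_measure X) x0).1 => //.
    by rewrite divr_gt0.
  have yd : \forall z \near y, ball y (delta / 4) z.
    by apply: nbhsx_ballx; rewrite divr_gt0.
  near=> z m => /= x xS xz.
  apply: (le_trans (_ : (m%:E <= c%:E)%E)).
    by rewrite lee_fin; near: m; exact: nbhs_right_le.
  apply: (le_trans cx0).
  apply: le_measure; rewrite ?inE;
    [exact: ball_borel|exact: closed_mball_borel|].
  move=> w; rewrite ball_mdist /closed_mball /= => x0w.
  have xx0 : mdist x x0 < delta / 2.
    rewrite -iso ?inE; [|by left|by left].
    have : ball y (delta / 4) z by near: z.
    rewrite -xz; move: yx0; rewrite !ball_mdist => yx0 yx.
    have := metric_triangle (phi x) y (phi x0); rewrite (metric_sym (phi x) y).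
    by lra.
  by have := metric_triangle x x0 w; lra.
move=> /(filterI (nbhs_right_gt 0))/filter_ex [m [m0 mP]].
by exists m => // x xS; exact: (mP (phi x) I x).
Unshelve. all: by end_near. Qed.

Lemma mm_equiv_total_mass {R : realType} (X Y : mmspace R) :
  mm_equiv X Y -> (mm_measure X [set: X] = mm_measure Y [set: Y]).
Proof.
move=> [phi [_ _ _ phimu]]; rewrite phimu// preimage_setT.
by rewrite measure_mm_rooted_suppI.
Qed.

(** * A compact subset as a complete metric space *)

(** A dedicated record rather than the sigma type attached to a set, because the
    universe of the latter is too large for the carrier of a
    [completeMetricType]. The proof of compactness is a parameter so that the
    complete structure can be inferred from the type, and the point [p] so that
    the type is pointed. *)
Record compact_subspace {R : realType} {T : completeMetricType R} {K : set T}
    (cK : compact K) {p : T} (Kp : K p) :=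
  CompactSubspace { subspace_val : T ; subspace_valP : subspace_val \in K }.
Arguments CompactSubspace {R T K} cK {p} Kp.

Section compact_subspace.
Context {R : realType} {T : completeMetricType R} {K : set T} {p : T}.
Variables (cK : compact K) (Kp : K p).
Local Notation S := (compact_subspace cK Kp).

HB.instance Definition _ := [isSub for @subspace_val _ _ _ cK _ Kp].
HB.instance Definition _ := [Choice of S by <:].
HB.instance Definition _ :=
  PseudoMetric.copy S (initial_topology (val : S -> T)).
HB.instance Definition _ := isPointed.Build S
  (CompactSubspace cK Kp _ (mem_set Kp)).

Lemma subspace_in (y : S) : K (val y).
Proof. exact/set_mem/subspace_valP. Qed.

Lemma compact_subspace_compact : compact [set: S].
Proof.
apply: initial_topology_compact; suff -> : range (val : S -> T) = K by [].
apply/seteqP; split => [_ [y _ <-]|x Kx]; first exact: subspace_in.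
by exists (CompactSubspace cK Kp _ (mem_set Kx)).
Qed.

Let subspace_cauchy_cvg (F : set_system S) :
  ProperFilter F -> cauchy F -> cvg F.
Proof.
move=> PF cF; apply: (compact_cauchy_cvg PF cF filterT).
exact: compact_subspace_compact.
Qed.

HB.instance Definition _ := Uniform_isComplete.Build S subspace_cauchy_cvg.

Let dist (x y : S) : R := mdist (val x) (val y).

Let dist_ge0 x y : 0 <= dist x y. Proof. exact: mdist_ge0. Qed.

Let dist_positivity x y : dist x y = 0 -> x = y.
Proof. by move=> /mdist_positivity; exact: val_inj. Qed.

Let ball_dist (x : S) d : ball x d = [set y | dist x y < d].
Proof. by apply/funext => y; exact: (ball_mdist (val x) d (val y)). Qed.

HB.instance Definition _ := PseudoMetric_isMetric.Build R S
  dist_ge0 dist_positivity ball_dist.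

Lemma compact_subspace_separable : separable S.
Proof.
apply: second_countable_separable; apply: (@compact_second_countable R).
exact: compact_subspace_compact.
Qed.

Lemma mdist_subspace (x y : S) : mdist x y = mdist (val x) (val y).
Proof. by []. Qed.

(** This is in general not continuous, as the complement of K is sent to [p],
    but it is Borel, and it is defined on all of T. *)
Definition retract (x : T) : S := insubd (point : S) x.

Lemma val_retract x : K x -> val (retract x) = x.
Proof. by move=> Kx; rewrite insubdK//; exact: mem_set. Qed.

Lemma val_retract_out x : ~ K x -> val (retract x) = p.
Proof. by move=> Kx; rewrite val_insubd ifF//; apply/negP => /set_mem. Qed.

Lemma retract_val (y : S) : retract (val y) = y.
Proof. by apply: val_inj; apply: val_retract; exact: subspace_in. Qed.

Lemma measurable_retract :
  measurable_fun setT (retract : borel T -> borel S).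
Proof.
apply: (@measurability _ _ (borel T) (borel S) setT retract (@open S)) => //.
move=> _ [B [W oW <-] <-].
have clK : closed K by apply: compact_closed => //; exact: metric_hausdorff.
have -> : setT `&` retract @^-1` (val @^-1` W) =
    (K `&` W) `|` (if `[< W p >] then ~` K else set0).
  rewrite setTI; apply/seteqP; split => x /=.
    have [Kx|nKx] := pselect (K x); first by rewrite val_retract//; left.
    by rewrite val_retract_out// => Wp; right; case: asboolP.
  move=> [[Kx Wx]|]; first by rewrite val_retract.
  by case: asboolP => // Wp nKx; rewrite val_retract_out.
apply: measurableU.
  by apply: measurableI; [exact: closed_borel|exact: open_borel].
by case: ifP => _ //; apply: measurableC; exact: closed_borel.
Qed.

(** This is the restriction of mu to K whenever the complement of K is a null
    set; otherwise [p] carries the missing mass as an atom. *)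
Definition retract_measure (mu : {measure set (borel T) -> \bar R}) :=
  pushforward mu (retract : borel T -> borel S).

Section retract_measure.
Variable mu : {measure set (borel T) -> \bar R}.

Let retract_measure0 : retract_measure mu set0 = 0%E.
Proof. by rewrite /retract_measure measure0//; exact: measurable_retract. Qed.

Let retract_measure_ge0 B : (0 <= retract_measure mu B)%E.
Proof. exact: (measure_ge0 mu). Qed.

Let retract_measure_sigma_additive : semi_sigma_additive (retract_measure mu).
Proof.
by apply: measure_semi_sigma_additive; exact: measurable_retract.
Qed.

HB.instance Definition _ := isMeasure.Build _ _ _ (retract_measure mu)
  retract_measure0 retract_measure_ge0 retract_measure_sigma_additive.

End retract_measure.

End compact_subspace.

(** * The equivalence *)

(** The isometry from X is the retraction onto its rooted support S. Every
    point of S other than the root stays in the support of the pushforward: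
    the preimage of a ball of S contains the trace on S of the ball of X with
    the same centre and radius, and that trace has the mass of the whole
    ball. *)
Lemma compact_rooted_supp_class {R : realType} (X : mmspace R) :
  (mm_measure X [set: X] < +oo)%E -> compact (mm_rooted_supp X) ->
  compact_class (mm_class X).
Proof.
move=> finX cK.
have Kr : mm_rooted_supp X (mm_root X) by right.
pose S : completeMetricType R := compact_subspace cK Kr.
pose f : borel X -> borel S := retract cK Kr.
have mf : measurable_fun setT f := measurable_retract cK Kr.
have mpre (B : set (borel S)) : measurable B -> measurable (f @^-1` B).
  by move=> mB; rewrite -[X in measurable X]setTI; exact: mf.
pose mu := retract_measure cK Kr (mm_measure X).
have bf (A : set (borel S)) : measurable A -> mbounded A -> (mu A < +oo)%E.
  move=> mA _; apply: le_lt_trans finX.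
  apply: (@le_measure _ _ _ (mm_measure X)); rewrite ?inE//; exact: mpre.
pose Y := @MMSpace R S (compact_subspace_separable cK Kr) (point : S) mu bf.
exists Y; last exact: compact_subspace_compact.
have suppY : mm_rooted_supp Y = setT.
  apply/seteqP; split => // y _.
  have [yX|yr] := subspace_in cK Kr y; last first.
    by right; exact: val_inj.
  left; apply/msupportP => e e0.
  have /lt_le_trans := (msupportP (mm_measure X) _).1 yX e e0; apply.
  rewrite -measure_mm_rooted_suppI; last exact: ball_borel.
  apply: le_measure; rewrite ?inE.
  - by apply: measurableI; [exact: mm_rooted_supp_borel|exact: ball_borel].
  - by apply: mpre; exact: ball_borel.
  - by move=> x [xX]; rewrite /= !ball_mdist mdist_subspace val_retract.
exists f; split.
- by move=> x y; rewrite !inE => xX yX; rewrite mdist_subspace !val_retract.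
- rewrite suppY; apply/seteqP; split => // y _; exists (val y).
    exact: subspace_in.
  exact: retract_val.
- by apply: val_inj; rewrite val_retract.
- by move=> B mB; rewrite measure_mm_rooted_suppI//; exact: mpre.
Qed.

Theorem lemma3p4 (R : realType) (X : mmspace R) :
  compact_class (mm_class X) <->
  (mm_measure X [set: X] < +oo)%E /\
  (forall delta : R, 0 < delta -> (0 < lower_mass X delta)%E).
Proof.
split=> [[Y XY cY]|[finX low]].
  split; last exact: mm_equiv_compact_lower_mass XY cY.
  by rewrite (mm_equiv_total_mass X Y XY); exact: compact_finite_mass.
apply: compact_rooted_supp_class => //.
apply: compactU; last exact: compact_set1.
apply: compact_totally_bounded; first exact: closed_msupport.
move=> e e0; have /lower_mass_gt0P[m m0 mX] : (0 < lower_mass X (e / 3))%E.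
  by apply: low; rewrite divr_gt0.
exact: mass_bound_totally_bounded mX.
Qed.
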